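(* Let $\alpha\in[0,1]$ and let $\mathcal H=\{(w_i,s_i,q_i)\}_{i=1}^T$, $T\ge3$, be a history with $\mathcal F_\alpha^Q(\mathcal H)\ne\varnothing$. For $i=2,\dots,T-1$, let $$[\underline\phi_i^Q,\overline\phi_i^Q]=\left[s_i+\frac{q_i}{\bar G_{\alpha,i-1}'(s_i)},\ s_i+\frac{q_i}{\bar G_{\alpha,i}'(s_i)}\right],\qquad \delta_i^{\mathrm{crit}}=\max\{w_i-\underline\phi_i^Q,\ \overline\phi_i^Q-w_i\}.$$ Let $\delta_i\ge0$ and consider the condition-error restriction $|\phi_F(s_i)-w_i|\le\delta_i$ imposed at transaction $i$. If $\delta_i<\delta_i^{\mathrm{crit}}$, the restriction excludes at least one Q-feasible demand behavior at $s_i$. If $\delta_i\ge\delta_i^{\mathrm{crit}}$, transaction $i$'s restriction is redundant: every Q-feasible demand behavior at $s_i$ satisfies it.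
   Context: Setting. Consumer valuations have distribution $F$ with density $f$ and tail demand $\bar F=1-F$; $\phi_F(s)=s-\bar F(s)/f(s)$. $F$ is $\alpha$-regular if $s\mapsto(1-\alpha)s-\bar F(s)/f(s)$ is nondecreasing. A history satisfies $s_1<\cdots<s_T$, $1>q_1>\cdots>q_T>0$, $s_i>w_i$. $\mathcal F_\alpha^Q(\mathcal H)=\{F\ \alpha\text{-regular}:\bar F(s_i)=q_i\ \forall i\}$. The condition-error (CE) ambiguity set is $\mathcal F_\alpha^{\mathrm{CE},\boldsymbol\delta}(\mathcal H)=\{F\in\mathcal F_\alpha^Q(\mathcal H):|\phi_F(s_i)-w_i|\le\delta_i\ \forall i\}$. Closure convention. Put $x_\alpha(q)=(q^{-(1-\alpha)}-1)/(1-\alpha)$ for $\alpha<1$, $x_1(q)=-\log q$, $Q_\alpha=x_\alpha^{-1}$, $v(x)=\bar F^{-1}(Q_\alpha(x))$; $\alpha$-regularity corresponds to $v$ increasing and concave, and curves with kinks in $v$ are admitted as limits. A Q-feasible demand behavior at $s_i$ is a curve $F\in\mathcal F_\alpha^Q(\mathcal H)$ together with a value $\phi$ of its pricing index at $s_i$: $\phi=\phi_F(s_i)$ at a smooth point, and at a kink any $\phi=s_i-q_i^{-(1-\alpha)}m$ with $m\in[v'_+(x_i),v'_-(x_i)]$, $x_i=x_\alpha(q_i)$; the restriction for it reads $|\phi-w_i|\le\delta_i$. Generalized-Pareto interpolation. $\bar\Gamma_\alpha(t)=[1+(1-\alpha)t]^{-1/(1-\alpha)}$ for $0\le\alpha<1$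 (where the bracket is positive), $\bar\Gamma_1(t)=e^{-t}$. For $j=1,\dots,T-1$, near $[s_j,s_{j+1}]$, $\bar G_{\alpha,j}(v)=q_j\bar\Gamma_\alpha\big(\bar\Gamma_\alpha^{-1}(q_{j+1}/q_j)\tfrac{v-s_j}{s_{j+1}-s_j}\big)$, the curve through $(s_j,q_j)$ and $(s_{j+1},q_{j+1})$; $\bar G'_{\alpha,j}$ is its derivative in $v$. *)

(* Defs.v *)
From HB Require Import structures.
From mathcomp Require Import all_boot all_order all_algebra.
From mathcomp Require Import all_classical all_reals all_analysis.

Set Implicit Arguments.
Unset Strict Implicit.
Unset Printing Implicit Defensive.
Import Order.TTheory GRing.Theory Num.Theory.
Import numFieldNormedType.Exports.

Local Open Scope classical_set_scope.
Local Open Scope ring_scope.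

(* The type [cumulativeBounded 0 1] of the library is the type of cumulative
   distribution functions on R. *)
Notation valuation_distr R := (cumulativeBounded (0 : R) (1 : R)).

Definition tail (R : realType) (F : valuation_distr R) (s : R) : R := 1 - F s.

Definition density (R : realType) (F : valuation_distr R) (s : R) : R :=
  derive1 (F : R -> R) s.

(* phi_F.  Since [_ / 0 = 0], it is meaningful only where the density is
   nonzero. *)
Definition pricing_index (R : realType) (F : valuation_distr R) (s : R) : R :=
  s - tail F s / density F s.

Definition in_support (R : realType) (F : valuation_distr R) (s : R) : Prop :=
  0 < tail F s < 1.

(* alpha-regularity of a curve that is smooth on its support.  Continuity of F
   rules out atoms at the ends of the support. *)
Definition alpha_regular (R : realType) (alpha : R) (F : valuation_distr R) :
    Prop :=
  [/\ continuous (F : R -> R),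
      forall s, in_support F s ->
        derivable (F : R -> R) s 1 /\ 0 < density F s
    & forall s t, in_support F s -> in_support F t -> s <= t ->
        (1 - alpha) * s - tail F s / density F s <=
        (1 - alpha) * t - tail F t / density F t].

(* The generalized Pareto tail.  For alpha < 1 it has its intended value only
   where the bracket is positive. *)
Definition gpareto (R : realType) (alpha t : R) : R :=
  if alpha == 1 then expR (- t)
  else (1 + (1 - alpha) * t) `^ (- (1 - alpha)^-1).

(* x_alpha, which is the inverse of [gpareto alpha]: see [gpareto_invK] and
   [gparetoK].  Hence Q_alpha = x_alpha^-1 is [gpareto alpha] itself. *)
Definition gpareto_inv (R : realType) (alpha q : R) : R :=
  if alpha == 1 then - ln q
  else (q `^ (- (1 - alpha)) - 1) / (1 - alpha).

Lemma gpareto_invK (R : realType) (alpha q : R) :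
  0 < q -> gpareto alpha (gpareto_inv alpha q) = q.
Proof.
rewrite /gpareto /gpareto_inv => q0; case: eqVneq => [_|a1].
  by rewrite opprK lnK.
have b0 : 1 - alpha != 0 by rewrite subr_eq0 eq_sym.
rewrite mulrC divfK// addrC subrK -powRrM mulrNN mulfV// powRr1//.
exact: ltW.
Qed.

Lemma gparetoK (R : realType) (alpha t : R) :
  0 < 1 + (1 - alpha) * t -> gpareto_inv alpha (gpareto alpha t) = t.
Proof.
rewrite /gpareto /gpareto_inv => t0; case: eqVneq => [_|a1].
  by rewrite expRK opprK.
have b0 : 1 - alpha != 0 by rewrite subr_eq0 eq_sym.
rewrite -powRrM mulrNN mulVf// powRr1; last exact: ltW.
by rewrite addrAC subrr add0r mulrC mulKf.
Qed.

(* The generalized inverse of the tail, for 0 < q < 1. *)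
Definition tail_inv (R : realType) (F : valuation_distr R) (q : R) : R :=
  inf [set s : R | tail F s <= q].

(* The curve v, used on ]0, +oo[, where 0 < Q_alpha x < 1. *)
Definition vcurve (R : realType) (alpha : R) (F : valuation_distr R) (x : R) : R :=
  tail_inv F (gpareto alpha x).

Definition increasing_concave_v (R : realType) (alpha : R)
    (F : valuation_distr R) : Prop :=
  (forall x y, 0 < x -> x < y -> vcurve alpha F x < vcurve alpha F y) /\
  convex_function (`]0, +oo[%classic : set R^o)
    (fun x => - vcurve alpha F x).

(* The class of alpha-regular curves under the closure convention: v may have
   kinks, where F has no derivative. *)
Definition alpha_regular_closed (R : realType) (alpha : R)
    (F : valuation_distr R) : Prop :=
  alpha_regular alpha F \/ increasing_concave_v alpha F.

(* A history is given by three sequences, of which only the values at the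
   indices 1, ..., T are relevant. *)
Definition is_history (R : realType) (T : nat) (w s q : nat -> R) : Prop :=
  [/\ forall i, (1 <= i < T)%N -> s i < s i.+1,
      q 1%N < 1,
      forall i, (1 <= i < T)%N -> q i.+1 < q i,
      0 < q T
    & forall i, (1 <= i <= T)%N -> w i < s i].

(* F_alpha^Q(H), which does not depend on the w_i. *)
Definition Qfeasible (R : realType) (alpha : R) (T : nat) (s q : nat -> R)
    (F : valuation_distr R) : Prop :=
  alpha_regular_closed alpha F /\
  forall i, (1 <= i <= T)%N -> tail F (s i) = q i.

Definition right_derivative (R : realType) (v : R -> R) (x m : R) : Prop :=
  (h^-1 * (v (x + h) - v x)) @[h --> 0^'+] --> m.

Definition left_derivative (R : realType) (v : R -> R) (x m : R) : Prop :=
  (h^-1 * (v (x + h) - v x)) @[h --> 0^'-] --> m.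

(* [phi] is a value of the pricing index of F at the point (s0, q0). *)
Definition pricing_index_value (R : realType) (alpha : R) (F : valuation_distr R)
    (s0 q0 phi : R) : Prop :=
  (derivable (F : R -> R) s0 1 /\ phi = pricing_index F s0) \/
  (exists vr vl m : R,
    [/\ right_derivative (vcurve alpha F) (gpareto_inv alpha q0) vr,
        left_derivative (vcurve alpha F) (gpareto_inv alpha q0) vl,
        vr < vl,
        vr <= m <= vl
      & phi = s0 - q0 `^ (- (1 - alpha)) * m]).

Definition Qfeasible_behavior (R : realType) (alpha : R) (T : nat)
    (s q : nat -> R) (i : nat) (F : valuation_distr R) (phi : R) : Prop :=
  Qfeasible alpha T s q F /\ pricing_index_value alpha F (s i) (q i) phi.

Definition CE_restriction (R : realType) (phi w delta : R) : Prop :=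
  `|phi - w| <= delta.

Definition Gbar (R : realType) (alpha : R) (s q : nat -> R) (j : nat) (v : R) :
    R :=
  q j * gpareto alpha
    (gpareto_inv alpha (q j.+1 / q j) * ((v - s j) / (s j.+1 - s j))).

Definition phiQ_lower (R : realType) (alpha : R) (s q : nat -> R) (i : nat) :
    R :=
  s i + q i / derive1 (Gbar alpha s q i.-1) (s i).

Definition phiQ_upper (R : realType) (alpha : R) (s q : nat -> R) (i : nat) :
    R :=
  s i + q i / derive1 (Gbar alpha s q i) (s i).

Definition delta_crit (R : realType) (alpha : R) (w s q : nat -> R) (i : nat) :
    R :=
  Num.max (w i - phiQ_lower alpha s q i) (phiQ_upper alpha s q i - w i).

(* Main.v *)
(* In the coordinate x = gpareto_inv alpha q, the interpolation Gbar_j is the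
   affine piece of v of slope c_j between the transactions j and j+1, and the
   pricing index at a point of the curve is s - q^(-(1 - alpha)) v'(x).  So
   phiQ_lower and phiQ_upper correspond to the chord slopes c_(i-1) and c_i.
   Concavity of v confines its one-sided derivatives at x_i between these two
   slopes, which gives redundancy.  Conversely, existence of a feasible curve
   makes the slopes c_j nonincreasing, so the piecewise affine interpolation of
   the history is itself feasible; it attains both extreme values at s_i,
   through its kink if c_i < c_(i-1) and as its derivative if c_i = c_(i-1). *)
Require Import Defs.
From HB Require Import structures.
From mathcomp Require Import all_boot all_order all_algebra.
From mathcomp Require Import all_classical all_reals all_analysis.
From mathcomp Require Import ring lra.
Set Implicit Arguments.
Unset Strict Implicit.
Import Order.TTheory GRing.Theory Num.Theory.
Import numFieldNormedType.Exports.
Local Open Scope classical_set_scope.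
Local Open Scope ring_scope.

(** * Signs of derivatives from one-sided comparisons *)

Lemma is_derive_affine (R : realType) (a b x : R) :
  is_derive x (1 : R) (fun t => a + b * t) b.
Proof. by apply: is_derive_eq; rewrite add0r mul1r; exact: mulr1. Qed.

Lemma is_derive_right_ge0 (R : realType) (f : R -> R) (x d : R) :
  is_derive x (1 : R) f d -> (\forall h \near 0^'+, f x <= f (x + h)) -> 0 <= d.
Proof.
move=> [df <-] fx.
have /cvg_dnbhs_at_right fd : h^-1 *: ((f \o shift x) (h *: 1) - f x) @[h --> 0^'] --> 'D_1 f x.
  exact: df.
apply: (cvgr_to_ge fd); near=> h.
have h0 : 0 < h by near: h; exact: nbhs_right_gt.
apply: mulr_ge0; first by rewrite invr_ge0 ltW.
rewrite subr_ge0 /= [h *: _]mulr1 addrC.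
by near: h.
Unshelve. all: by end_near. Qed.

Lemma is_derive_left_ge0 (R : realType) (f : R -> R) (x d : R) :
  is_derive x (1 : R) f d -> (\forall h \near 0^'+, f (x - h) <= f x) -> 0 <= d.
Proof.
move=> fd fx.
(* The reflection [t |-> - f (- t)] has at [- x] the derivative that [f] has at [x], and it turns
   increments to the left into increments to the right. *)
have fd' : is_derive (- x) (1 : R) (fun t => - f (- t)) d.
  have dN : is_derive (- x) (1 : R) -%R (-1) by exact: is_deriveNid.
  have fd'' : is_derive (- - x) (1 : R) f d by rewrite opprK.
  have := is_deriveN (@is_derive1_comp R _ _ _ _ _ fd'' dN).
  by rewrite mulrN1 opprK.
apply: (is_derive_right_ge0 fd'); near=> h.
by rewrite opprD !opprK lerN2; near: h.
Unshelve. all: by end_near. Qed.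

(** * Calculus of the generalized Pareto tail and of its inverse *)

Lemma gpareto0 (R : realType) (alpha : R) : gpareto alpha 0 = 1.
Proof.
rewrite /gpareto; case: ifP => _; first by rewrite oppr0 expR0.
by rewrite mulr0 addr0 powR1.
Qed.

Lemma gpareto_gt0 (R : realType) (alpha x : R) :
  0 < 1 + (1 - alpha) * x -> 0 < gpareto alpha x.
Proof. by rewrite /gpareto; case: ifP => _ h; rewrite ?expR_gt0 ?powR_gt0. Qed.

(** At [alpha = 1] both sides are 1. Through this identity the later formulas, written with the
    bracket or with [q] raised to [- (1 - alpha)], cover the exponential and the power case at
    once. *)
Lemma gpareto_bracket (R : realType) (alpha q : R) : 0 < q ->
  1 + (1 - alpha) * gpareto_inv alpha q = q `^ (- (1 - alpha)).
Proof.
rewrite /gpareto_inv => q0; case: eqVneq => [->|a1].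
  by rewrite subrr mul0r addr0 oppr0 powRr0.
by rewrite mulrC divfK ?subr_eq0 1?eq_sym// addrC subrK.
Qed.

Lemma is_derive_gpareto (R : realType) (alpha x : R) :
  0 < 1 + (1 - alpha) * x ->
  is_derive x (1 : R) (gpareto alpha)
    (- (gpareto alpha x / (1 + (1 - alpha) * x))).
Proof.
rewrite /gpareto; case: eqVneq => [->|a1] h.
  by apply: is_derive_eq; rewrite /= subrr mul0r addr0 divr1 mulrN1.
have b0 : 1 - alpha != 0 by rewrite subr_eq0 eq_sym.
have d1 := is_derive_affine 1 (1 - alpha) x.
have d2 := is_derive1_powR (- (1 - alpha)^-1) h.
apply: (is_derive_eq (@is_derive1_comp R _ _ x _ _ d2 d1)).
rewrite powRB; last by rewrite (gt_eqF h) implybT.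
by rewrite powRr1 ?ltW// mulrAC mulNr mulVf// mulN1r.
Qed.

Lemma is_derive_gpareto_inv (R : realType) (alpha q : R) : 0 < q ->
  is_derive q (1 : R) (gpareto_inv alpha) (- (q `^ (- (1 - alpha)) / q)).
Proof.
rewrite /gpareto_inv => q0; case: eqVneq => [->|a1].
  rewrite subrr oppr0 powRr0 div1r.
  exact: is_deriveN (is_derive1_ln q0).
have b0 : 1 - alpha != 0 by rewrite subr_eq0 eq_sym.
have d2 := is_derive1_powR (- (1 - alpha)) q0.
have d1 := is_derive_affine (- (1 - alpha)^-1) (1 - alpha)^-1 (q `^ (- (1 - alpha))).
have d3 := @is_derive1_comp R _ ((@powR R)^~ (- (1 - alpha))) q _ _ d1 d2.
rewrite (_ : (fun q => _) = (fun t => - (1 - alpha)^-1 + (1 - alpha)^-1 * t) \o (@powR R)^~ (- (1 - alpha))); last first.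
  by apply/funext => t /=; rewrite mulrBl mul1r addrC mulrC.
apply: (is_derive_eq d3).
rewrite powRB; last by rewrite (gt_eqF q0) implybT.
by rewrite powRr1 ?ltW// mulrA mulrN mulVf// mulN1r.
Qed.

Lemma gpareto_lt (R : realType) (alpha x y : R) : alpha <= 1 ->
  0 < 1 + (1 - alpha) * x -> x < y -> gpareto alpha y < gpareto alpha x.
Proof.
rewrite /gpareto => a1 h xy; case: eqVneq => [_|a1'].
  by rewrite ltr_expR ltrN2.
have b0 : 0 < 1 - alpha by rewrite subr_gt0 lt_neqAle a1' a1.
have xy' : 1 + (1 - alpha) * x < 1 + (1 - alpha) * y.
  by rewrite ltrD2l ltr_pM2l.
have y0 := lt_trans h xy'.
rewrite !powRN ltf_pV2 ?posrE ?powR_gt0//.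
by rewrite gt0_ltr_powR ?invr_gt0// nnegrE ltW.
Qed.

Lemma gpareto_le (R : realType) (alpha x y : R) : alpha <= 1 ->
  0 < 1 + (1 - alpha) * x -> x <= y -> gpareto alpha y <= gpareto alpha x.
Proof.
by move=> a1 h; rewrite le_eqVlt => /predU1P[->//|xy]; exact/ltW/gpareto_lt.
Qed.

Lemma bracket_gt0 (R : realType) (alpha x : R) : alpha <= 1 -> 0 <= x ->
  0 < 1 + (1 - alpha) * x.
Proof. by move=> a1 x0; rewrite ltr_pwDl// mulr_ge0// subr_ge0. Qed.

Lemma gpareto_lt1 (R : realType) (alpha x : R) : alpha <= 1 -> 0 < x ->
  gpareto alpha x < 1.
Proof.
by move=> a1 x0; rewrite -(gpareto0 alpha) gpareto_lt// mulr0 addr0.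
Qed.

Lemma gpareto_inv_lt (R : realType) (alpha p q : R) : alpha <= 1 ->
  0 < p -> p < q -> gpareto_inv alpha q < gpareto_inv alpha p.
Proof.
move=> a1 p0 pq; have q0 := lt_trans p0 pq.
rewrite ltNge; apply/negP => h.
suff : q <= p by rewrite leNgt pq.
rewrite -(gpareto_invK alpha p0) -[leLHS](gpareto_invK alpha q0).
by rewrite gpareto_le// gpareto_bracket// powR_gt0.
Qed.

Lemma gpareto_inv_le (R : realType) (alpha p q : R) : alpha <= 1 ->
  0 < p -> p <= q -> gpareto_inv alpha q <= gpareto_inv alpha p.
Proof.
by move=> a1 h; rewrite le_eqVlt => /predU1P[->//|xy]; exact/ltW/gpareto_inv_lt.
Qed.

Lemma gpareto_inv_gt0 (R : realType) (alpha q : R) : alpha <= 1 ->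
  0 < q < 1 -> 0 < gpareto_inv alpha q.
Proof.
move=> a1 /andP[q0 q1].
by rewrite -(gparetoK (alpha := alpha) (t := 0)) ?mulr0 ?addr0// gpareto0 gpareto_inv_lt.
Qed.

Lemma cvgy_gpareto (R : realType) (alpha : R) : alpha <= 1 ->
  gpareto alpha x @[x --> +oo] --> (0 : R).
Proof.
move=> a1; apply/cvgrPdist_lt => e e0.
(* The cap [2^-1] keeps [d] below 1, so that [gpareto_inv alpha d] is positive and the bracket is
   positive at every larger [x]. *)
pose d := Num.min e 2^-1.
have d0 : 0 < d by rewrite lt_min e0 invr_gt0 ltr0n.
have d1 : 0 < gpareto_inv alpha d.
  by rewrite gpareto_inv_gt0// d0/= gt_min orbC invf_lt1 ?ltr1n.
near=> x.
have dx : gpareto_inv alpha d < x by near: x; apply: nbhs_pinfty_gt; exact: num_real.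
have x0 : 0 < 1 + (1 - alpha) * x.
  by rewrite bracket_gt0// ltW// (lt_trans d1).
rewrite sub0r normrN gtr0_norm ?gpareto_gt0//.
have : gpareto alpha x < d.
  by rewrite -[ltRHS](gpareto_invK alpha d0) gpareto_lt// gpareto_bracket// powR_gt0.
by move/lt_le_trans; apply; rewrite /d ge_min lexx.
Unshelve. all: by end_near. Qed.

(** * The generalized inverse of a tail *)

Section Tail.
Variables (R : realType) (F : valuation_distr R).

Lemma tail_le (s t : R) : s <= t -> tail F t <= tail F s.
Proof. by move=> st; rewrite lerD2l lerN2; exact: cumulative_is_nondecreasing. Qed.

Lemma tail_lt_ex (q : R) : 0 < q -> exists s, tail F s < q.
Proof.
move=> q0; have /cvgrPdist_lt/(_ _ q0) := cumulativey F.
by move=> /filter_ex[s hs]; exists s; exact: le_lt_trans (ler_norm _) hs.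
Qed.

Lemma tail_gt_ex (q : R) : q < 1 -> exists s, q < tail F s.
Proof.
rewrite -subr_gt0 => q1; have /cvgrPdist_lt/(_ _ q1) := cumulativeNy F.
move=> /filter_ex[s]; rewrite sub0r normrN => hs; exists s.
by rewrite /tail ltrBrDl -ltrBrDr; exact: le_lt_trans (ler_norm _) hs.
Qed.

(** Since the tail tends to 1 at [-oo], the bound [q < 1] makes the set in [tail_inv] bounded below,
    so that [inf] is a genuine infimum and not a default value. *)
Lemma tail_inv_le (q s : R) : q < 1 -> tail F s <= q -> tail_inv F q <= s.
Proof.
move=> q1 sq; apply: ge_inf => //; have [t ht] := tail_gt_ex q1.
exists t => u /= uq; rewrite leNgt; apply/negP => ut.
by have := lt_le_trans ht (tail_le (ltW ut)); rewrite ltNge uq.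
Qed.

(** Here [0 < q] serves to make the set nonempty, the tail tending to 0 at [+oo]. *)
Lemma tail_inv_ge (q s : R) : 0 < q -> (forall t, tail F t <= q -> s <= t) ->
  s <= tail_inv F q.
Proof.
move=> q0 h; apply: lb_le_inf; last by move=> t /h.
by have [t ht] := tail_lt_ex q0; exists t; exact: ltW.
Qed.

End Tail.

(** * Consequences of an increasing concave [v] *)

Section VCurve.
Variables (R : realType) (alpha : R) (F : valuation_distr R).
Hypothesis alpha_le1 : alpha <= 1.
Local Notation v := (vcurve alpha F).
Local Notation X := (gpareto_inv alpha).

(** Unfolds the library's convexity of [- v], stated with bundled weights, into an inequality
    between real numbers. *)
Lemma increasing_concave_vP :
  increasing_concave_v alpha F <->
  (forall x y, 0 < x -> x < y -> v x < v y) /\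
  (forall l x y, 0 <= l <= 1 -> 0 < x -> 0 < y ->
    l * v x + (1 - l) * v y <= v (l * x + (1 - l) * y)).
Proof.
split=> -[vi vc]; split=> //.
- move=> l x y /andP[l0 l1] x0 y0.
  have := vc (Itv01 l0 l1) x y; rewrite !inE/= !in_itv/= !andbT.
  move=> /(_ x0 y0) h.
  have {}h : - v (l * x + (1 - l) * y) <= l * - v x + (1 - l) * - v y := h.
  by rewrite -lerN2 opprD -!mulrN.
- move=> t x y; rewrite !inE/= !in_itv/= !andbT => x0 y0.
  suff : - v (t%:num * x + (1 - t%:num) * y) <=
         t%:num * - v x + (1 - t%:num) * - v y by [].
  have -> : t%:num * - v x + (1 - t%:num) * - v y =
      - (t%:num * v x + (1 - t%:num) * v y) by ring.
  by rewrite lerN2; apply: vc => //; rewrite ge0 le1.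
Qed.

Hypothesis Fv : increasing_concave_v alpha F.

(** The slopes of adjacent chords of a concave function decrease; denominators are cleared so that
    later steps are linear arithmetic. *)
Lemma vcurve_chord (a b c : R) : 0 < a -> a < b -> b < c ->
  (v c - v b) * (b - a) <= (v b - v a) * (c - b).
Proof.
move=> a0 ab bc; have ac := lt_trans ab bc.
have [_ vc] := (increasing_concave_vP.1 Fv).
have ca : 0 < c - a by rewrite subr_gt0.
have ca0 : c - a != 0 by rewrite gt_eqF.
(* The weight for which [b = l * a + (1 - l) * c]. *)
pose l := (c - b) / (c - a).
have l01 : 0 <= l <= 1.
  rewrite /l ler_pdivrMr// mul1r lerD2l lerN2 (ltW ab) andbT.
  by rewrite divr_ge0// ?(ltW ca)// subr_ge0 ltW.
have := vc l a c l01 a0 (lt_trans a0 ac).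
have -> : l * a + (1 - l) * c = b by rewrite /l; field.
have -> : l * v a + (1 - l) * v c = ((c - b) * v a + (b - a) * v c) / (c - a).
  by rewrite /l; field.
by rewrite ler_pdivrMr// => h; lra.
Qed.

(** The infimum gives [<=]. A strict inequality would mean that the tail is flat to the left of [s],
    hence that [v] jumps at [x]; a concave function on the open half-line has no jump. *)
Lemma vcurve_gpareto_inv (s : R) : in_support F s -> v (X (tail F s)) = s.
Proof.
move=> /[dup] sF /andP[q0 q1]; set q := tail F s; set x := X q.
have x0 : 0 < x by exact: gpareto_inv_gt0.
have xq : gpareto alpha x = q by exact: gpareto_invK.
apply/eqP; rewrite eq_le; apply/andP; split.
  by rewrite /vcurve xq tail_inv_le.
have vs z : x < z -> s <= v z.
  move=> xz; apply: tail_inv_ge.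
    by rewrite gpareto_gt0// bracket_gt0// ltW// (lt_trans x0).
  move=> t tz; rewrite leNgt; apply/negP => /ltW/(tail_le F).
  rewrite leNgt => /negP; apply; apply: le_lt_trans tz _.
  by rewrite -/q -xq gpareto_lt// bracket_gt0// ltW.
rewrite leNgt; apply/negP => vxs.
have x2 : x / 2 < x by lra.
have x20 : 0 < x / 2 by lra.
have D0 : 0 < v x - v (x / 2) by rewrite subr_gt0 Fv.1.
(* The length [e] is so small that the chord from [x / 2] to [x] allows [v] to rise on [[x, x + e]]
   by only half of [s - v x], whereas the jump forces a rise of at least [s - v x]. *)
pose e := (s - v x) * (x / 2) / (v x - v (x / 2)) / 2.
have K0 : 0 < (s - v x) * (x / 2) by rewrite mulr_gt0// subr_gt0.
have e0 : 0 < e by rewrite !divr_gt0.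
have xe : x < x + e by rewrite ltrDl.
have := vcurve_chord x20 x2 xe.
have -> : (v x - v (x / 2)) * (x + e - x) = (s - v x) * (x / 2) / 2.
  by rewrite /e; field; rewrite gt_eqF.
have : (s - v x) * (x / 2) <= (v (x + e) - v x) * (x - x / 2).
  have -> : x - x / 2 = x / 2 by field.
  by rewrite ler_pM2r// lerD2r vs.
by lra.
Qed.

(** If the tail at [v x] were smaller, a level [p] could be placed between the two values. Then
    [X p > x], although [v (X p) <= v x], against the strict increase of [v]. *)
Lemma gpareto_le_tail_vcurve (x : R) : 0 < x -> gpareto alpha x <= tail F (v x).
Proof.
move=> x0; rewrite leNgt; apply/negP => h.
(* The second entry keeps [p] positive even if the tail vanishes at [v x]. *)
pose p := Num.max (tail F (v x)) (gpareto alpha (x + 1)).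
have bx1 : 0 < 1 + (1 - alpha) * (x + 1) by rewrite bracket_gt0// addr_ge0// ltW.
have bx : 0 < 1 + (1 - alpha) * x by rewrite bracket_gt0// ltW.
have p0 : 0 < p by rewrite lt_max gpareto_gt0// orbT.
have px : p < gpareto alpha x by rewrite gt_max h gpareto_lt// ltrDl.
have p1 := lt_trans px (gpareto_lt1 alpha_le1 x0).
have xp : x < X p by rewrite -[ltLHS](gparetoK bx) gpareto_inv_lt.
have := Fv.1 _ _ x0 xp; rewrite ltNge => /negP; apply.
by rewrite [leLHS]/vcurve gpareto_invK// tail_inv_le// le_max lexx.
Qed.

End VCurve.

(** * From convexity of [X \o tail F] to concavity of [v] *)

Section ConvexTail.
Variables (R : realType) (alpha : R) (F : valuation_distr R).
Hypothesis alpha_le1 : alpha <= 1.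
Local Notation v := (vcurve alpha F).
Local Notation X := (gpareto_inv alpha).

(** Converse of [vcurve_chord]: a weight strictly between 0 and 1 gives an interior point [b] whose
    two chords have lengths proportional to [1 - m] and [m]. *)
Lemma increasing_concave_v_chord :
  (forall x y, 0 < x -> x < y -> v x < v y) ->
  (forall a b c, 0 < a -> a < b -> b < c ->
    (v c - v b) * (b - a) <= (v b - v a) * (c - b)) ->
  increasing_concave_v alpha F.
Proof.
move=> vi chord; apply/increasing_concave_vP; split => // l x y.
have lt_case (m a c : R) : 0 <= m <= 1 -> 0 < a -> a < c ->
    m * v a + (1 - m) * v c <= v (m * a + (1 - m) * c).
  move=> /andP[m0 m1] a0 ac.
  have [->|m0'] := eqVneq m 0; first by rewrite subr0 !mul0r !add0r !mul1r.
  have [->|m1'] := eqVneq m 1; first by rewrite subrr !mul0r !addr0 !mul1r.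
  have {}m0 : 0 < m by rewrite lt_neqAle eq_sym m0' m0.
  have {}m1 : 0 < 1 - m by rewrite subr_gt0 lt_neqAle m1' m1.
  have ca : 0 < c - a by rewrite subr_gt0.
  set b := m * a + (1 - m) * c.
  have ba : b - a = (1 - m) * (c - a) by rewrite /b; ring.
  have cb : c - b = m * (c - a) by rewrite /b; ring.
  have : (v c - v b) * (b - a) <= (v b - v a) * (c - b).
    by apply: chord => //; rewrite -subr_gt0 ?ba ?cb mulr_gt0.
  by rewrite ba cb !mulrA ler_pM2r//; lra.
move=> /andP[l0 l1] x0 y0; have [xy|yx|->] := ltgtP x y.
- by apply: lt_case => //; rewrite l0.
- have := @lt_case (1 - l) y x; rewrite subKr => lc.
  by rewrite addrC [l * x + _]addrC; apply: lc => //; rewrite subr_ge0 l1 gerBl.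
- by rewrite -!mulrDl addrC subrK !mul1r.
Qed.

Hypothesis Fcont : continuous (F : R -> R).
Hypothesis tail_decr : forall s t, in_support F s -> in_support F t -> s < t ->
  tail F t < tail F s.

Lemma tail_surj (q : R) : 0 < q < 1 -> exists s, tail F s = q.
Proof.
move=> /andP[q0 q1]; have [a qa] := tail_gt_ex F q1.
have [b bq] := tail_lt_ex F q0.
have ab : a <= b.
  rewrite leNgt; apply/negP => /ltW/(tail_le F).
  by move/(lt_le_trans qa); rewrite ltNge (ltW bq).
have Fa : F a <= 1 - q by move: qa; rewrite /tail; lra.
have Fb : 1 - q <= F b by move: bq; rewrite /tail; lra.
have [||c _ Fc] := @IVT R F a b (1 - q) ab.
- exact: continuous_subspaceT.
- by rewrite ge_min Fa/= le_max Fb orbT.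
- by exists c; rewrite /tail Fc; ring.
Qed.

(** The conclusion of [vcurve_gpareto_inv] before concavity is known: strict decrease of the tail
    now rules out flat stretches. *)
Lemma vcurve_gpareto_inv_decr (s : R) : in_support F s -> v (X (tail F s)) = s.
Proof.
move=> /[dup] sF /andP[q0 q1].
rewrite /vcurve gpareto_invK//; apply/eqP; rewrite eq_le tail_inv_le//=.
apply: tail_inv_ge => // t ts; rewrite leNgt; apply/negP => lts.
have tq : tail F t = tail F s by apply/eqP; rewrite eq_le ts tail_le// ltW.
have tF : in_support F t by rewrite /in_support tq.
by have := tail_decr tF sF lts; rewrite tq ltxx.
Qed.

(** By the intermediate value theorem every level in []0, 1[] is attained, so the support
    parametrizes the whole domain of [v]. *)
Lemma vcurve_tailP (x : R) : 0 < x -> exists2 s, in_support F s &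
  X (tail F s) = x /\ v x = s.
Proof.
move=> x0.
have bx : 0 < 1 + (1 - alpha) * x by rewrite bracket_gt0// ltW.
have [|s sx] := @tail_surj (gpareto alpha x).
  by rewrite gpareto_gt0//= gpareto_lt1.
have sF : in_support F s by rewrite /in_support sx gpareto_gt0//= gpareto_lt1.
exists s => //; have Xs : X (tail F s) = x by rewrite sx gparetoK.
by rewrite -[in v x]Xs vcurve_gpareto_inv_decr.
Qed.

Hypothesis tail_convex : forall s t u, in_support F s -> in_support F t ->
  in_support F u -> s < t -> t < u ->
  (X (tail F t) - X (tail F s)) * (u - t) <=
  (X (tail F u) - X (tail F t)) * (t - s).

(** On the support [v] inverts the increasing function [X \o tail F]. Exchanging abscissas and
    ordinates turns the chord inequality of the one into that of the other. *)
Lemma convex_increasing_concave_v : increasing_concave_v alpha F.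
Proof.
have vi x y : 0 < x -> x < y -> v x < v y.
  move=> x0 xy; have [s /[dup] sF /andP[s0 _] [sx ->]] := vcurve_tailP x0.
  have [t /[dup] tF /andP[t0 _] [ty ->]] := vcurve_tailP (lt_trans x0 xy).
  rewrite ltNge; apply/negP => /(tail_le F) st.
  by move: xy; rewrite -sx -ty ltNge gpareto_inv_le.
apply: increasing_concave_v_chord => // a b c a0 ab bc.
have := vi _ _ a0 ab; have := vi _ _ (lt_trans a0 ab) bc.
have [s sF [sx ->]] := vcurve_tailP a0.
have [t tF [tx ->]] := vcurve_tailP (lt_trans a0 ab).
have [u uF [ux ->]] := vcurve_tailP (lt_trans (lt_trans a0 ab) bc).
move=> tu st; have := tail_convex sF tF uF st tu.
by rewrite sx tx ux mulrC [leRHS]mulrC.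
Qed.

End ConvexTail.

(** * Smooth alpha-regular curves have an increasing concave [v] *)

Lemma derive_nondecreasing_chord (R : realType) (f df : R -> R) (a b c : R) :
  a < b -> b < c ->
  (forall x, a <= x <= c -> is_derive x (1 : R) f (df x)) ->
  (forall x y, a <= x <= c -> a <= y <= c -> x <= y -> df x <= df y) ->
  (f b - f a) * (c - b) <= (f c - f b) * (b - a).
Proof.
move=> ab bc fd dfi.
have fcont x : a <= x <= c -> {for x, continuous f}.
  move=> /fd[+ _]; move=> /derivable1_diffP/differentiable_continuous; exact.
have mvt x y : a <= x -> x < y -> y <= c ->
    exists2 z, x < z < y & f y - f x = df z * (y - x).
  move=> ax xy yc.
  have [z|z zxy|z + fz] := @MVT R f df x y xy.
  - rewrite in_itv/= => /andP[xz zy]; apply: fd.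
    by rewrite (le_trans ax (ltW xz)) (le_trans (ltW zy) yc).
  - apply: continuous_in_subspaceT => {}z.
    rewrite inE/= in_itv/= => /andP[xz zy]; apply: fcont.
    by rewrite (le_trans ax xz) (le_trans zy yc).
  - by rewrite in_itv; exists z.
(* Each chord slope is the derivative at a mean value point, and the two points lie on opposite
   sides of [b]. *)
have [x /andP[ax xb] ->] := mvt a b (lexx _) ab (ltW bc).
have [y /andP[by_ yc] ->] := mvt b c (ltW ab) bc (lexx _).
have xy : df x <= df y.
  apply: dfi; first by rewrite !ltW// (lt_trans xb).
    by rewrite !ltW// (lt_trans _ by_).
  by rewrite ltW// (lt_trans xb).
rewrite mulrAC ler_wpM2r ?subr_ge0 ?(ltW ab)//.
by rewrite ler_wpM2r// subr_ge0 ltW.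
Qed.

Section SmoothRegular.
Variables (R : realType) (alpha : R) (F : valuation_distr R).
Hypothesis alpha_le1 : alpha <= 1.
Hypothesis FR : alpha_regular alpha F.
Local Notation b := (1 - alpha).
Local Notation X := (gpareto_inv alpha).
Local Notation g := (fun s => tail F s / density F s).

Lemma in_support_itv (s t u : R) : in_support F s -> in_support F u ->
  s <= t <= u -> in_support F t.
Proof.
move=> /andP[s0 s1] /andP[u0 u1] /andP[st tu]; apply/andP; split.
  exact: lt_le_trans u0 (tail_le F tu).
exact: le_lt_trans (tail_le F st) s1.
Qed.

Lemma is_derive_tail (s : R) : in_support F s ->
  is_derive s (1 : R) (tail F) (- density F s).
Proof.
case: FR => _ + _ => /[apply] -[Fd _].
have dF : is_derive s (1 : R) (F : R -> R) (density F s).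
  by rewrite /density derive1E; exact: derivableP.
have -> : tail F = cst 1 - (F : R -> R) by [].
have := is_deriveB (is_derive_cst (1 : R) s (1 : R)) dF; rewrite sub0r.
exact.
Qed.

Lemma density_gt0 (s : R) : in_support F s -> 0 < density F s.
Proof. by case: FR => _ + _ => /[apply] -[]. Qed.

(* The ratio is 1 / U', for U = gpareto_inv alpha \o tail F; hence U is convex.
   The density need not be differentiable, so the proof freezes g at s and uses
   regularity in the form g r <= g s + (1 - alpha) (r - s). *)
Lemma regular_ratio_nonincreasing (s t : R) :
  in_support F s -> in_support F t -> s <= t ->
  tail F t `^ b * g t <= tail F s `^ b * g s.
Proof.
move=> sF tF st.
have gt r : in_support F r -> s <= r -> g r <= g s + b * (r - s).
  by case: FR => _ _ h rF sr; have := h s r sF rF sr; lra.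
have b0 : 0 <= b by rewrite subr_ge0.
(* [M] puts the upper bound of [g r] in place of [g r]. It equals the ratio at [s], dominates it at
   [t], and is nonincreasing because the bound makes the last factor of its derivative
   nonpositive. *)
pose M r := tail F r `^ b * (g s + b * (r - s)).
have Md r : s <= r <= t -> is_derive r (1 : R) M
   (b * tail F r `^ b * (1 - (g s + b * (r - s)) / g r)).
  move=> /(in_support_itv sF tF) /[dup] rF /andP[r0 r1].
  have d1 := is_derive1_powR b r0.
  have d2 := @is_derive1_comp R _ (tail F) r _ _ d1 (is_derive_tail rF).
  have d3 := is_derive_affine (g s - b * s) b r.
  rewrite (_ : M = ((@powR R)^~ b \o tail F) *
      (fun t => g s - b * s + b * t)); last first.
    by apply/funext => x; rewrite /M fctE /=; congr (_ * _); ring.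
  apply: (is_derive_eq (is_deriveM d2 d3)) => /=.
  rewrite (@powRB _ _ b 1); last by rewrite (gt_eqF r0) implybT.
  rewrite powRr1 ?ltW// /GRing.scale/=.
  have f0 := density_gt0 rF; have fs0 := density_gt0 sF.
  by field; rewrite !gt_eqF.
have Mle : M t <= M s.
  apply: (@ler0_derive1_le_cc R M s t) => //.
  - move=> r; rewrite in_itv/= => /andP[sr rt].
    by have [] := Md r; rewrite ?ltW.
  - move=> r; rewrite in_itv/= => /andP[sr rt].
    have rF : in_support F r by apply: (in_support_itv sF tF); rewrite !ltW.
    have gr0 : 0 < g r.
      by rewrite divr_gt0// ?density_gt0//; case/andP: rF.
    rewrite derive1E (@derive_val _ _ _ _ _ _ _ (Md r _)); last by rewrite !ltW.
    rewrite mulr_ge0_le0// ?mulr_ge0 ?powR_ge0// subr_le0 ler_pdivlMr// mul1r.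
    by rewrite gt// ltW.
  - apply: continuous_in_subspaceT => r; rewrite inE/= in_itv/= => /Md[+ _].
    by move=> /derivable1_diffP/differentiable_continuous.
  - by rewrite in_itv/= st lexx.
  - by rewrite in_itv/= st lexx.
apply: (@le_trans _ _ (M t)); first by rewrite ler_wpM2l ?powR_ge0// gt.
by apply: (le_trans Mle); rewrite /M subrr mulr0 addr0.
Qed.

(** This reduces the smooth alternative of [alpha_regular_closed] to the concave one, so that
    feasible curves can be treated uniformly. *)
Lemma regular_increasing_concave_v : increasing_concave_v alpha F.
Proof.
have [Fc _ _] := FR.
pose U' r := (tail F r `^ b * g r)^-1.
have Ud r : in_support F r -> is_derive r (1 : R) (X \o tail F) (U' r).
  move=> /[dup] rF /andP[r0 r1].
  have d1 := is_derive_gpareto_inv alpha r0.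
  apply: (is_derive_eq (is_derive1_comp d1 (is_derive_tail rF))).
  rewrite /U' powRN; have f0 := density_gt0 rF.
  by field; rewrite !gt_eqF// powR_gt0.
apply: convex_increasing_concave_v => // [s t sF tF st|s t u sF tF uF st tu].
  have [x|x|x + Fx] := @MVT R (tail F) (fun x => - density F x) s t st.
  - rewrite in_itv/= => /andP[sx xt]; apply/is_derive_tail.
    by apply: (in_support_itv sF tF); rewrite !ltW.
  - by apply: continuousB; [exact: cst_continuous|exact: continuous_subspaceT].
  - rewrite in_itv/= => /andP[sx xt].
    rewrite -subr_lt0 Fx mulNr oppr_lt0 mulr_gt0 ?subr_gt0//.
    by apply/density_gt0/(in_support_itv sF tF); rewrite !ltW.
apply: (@derive_nondecreasing_chord R (X \o tail F) U') => // [x|x y] sx.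
  exact/Ud/(in_support_itv sF uF).
move=> sy xy; rewrite /U'.
have xF := in_support_itv sF uF sx; have yF := in_support_itv sF uF sy.
have pos z : in_support F z -> 0 < tail F z `^ b * g z.
  move=> /[dup] zF /andP[z0 z1]; rewrite mulr_gt0 ?powR_gt0// divr_gt0//.
  exact: density_gt0.
by rewrite lef_pV2 ?posrE ?pos// regular_ratio_nonincreasing.
Qed.

End SmoothRegular.

(** * Rearranged chord inequalities and scaling of Pareto tails *)

Section ChordArithmetic.
Variables (R : realFieldType) (a b c fa fb fc : R).
Hypothesis chord : (fc - fb) * (b - a) <= (fb - fa) * (c - b).

(** For [a < b < c] the three rearrangements say that the graph at [b] lies above the chord from [a]
    to [c], at [a] below the prolonged chord through [b] and [c], and at [c] below the one through
    [a] and [b]. *)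
Lemma chord_le_interp : (fc - fa) * (b - a) <= (fb - fa) * (c - a).
Proof. by move: chord; lra. Qed.

Lemma chord_extend_left : (fa - fb) * (c - b) <= (a - b) * (fc - fb).
Proof. by move: chord; lra. Qed.

Lemma chord_extend_right : (fc - fa) * (b - a) <= (c - a) * (fb - fa).
Proof. by move: chord; lra. Qed.

End ChordArithmetic.

(** The bracket at the new argument is the product of the brackets at [gpareto_inv alpha q] and at
    [t]; for [alpha = 1] this is the exponential law. Scaling a tail is thus an affine change of the
    coordinate, which makes [Gbar] affine there. *)
Lemma gpareto_mul (R : realType) (alpha q t : R) : 0 < q ->
  0 < 1 + (1 - alpha) * t ->
  q * gpareto alpha t =
  gpareto alpha (gpareto_inv alpha q + q `^ (- (1 - alpha)) * t).
Proof.
move=> q0 bt; rewrite -[in LHS](gpareto_invK alpha q0).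
have := gpareto_bracket alpha q0.
rewrite /gpareto /gpareto_inv; case: eqVneq => [->|a1] bq.
  by rewrite subrr oppr0 powRr0 mul1r -expRD opprD.
rewrite bq -powRM ?powR_ge0 ?(ltW bt)//.
by congr powR; rewrite [in RHS]mulrDr addrA bq; ring.
Qed.

Lemma gpareto_inv_div (R : realType) (alpha p q : R) : 0 < p -> 0 < q ->
  gpareto_inv alpha p =
  gpareto_inv alpha q + q `^ (- (1 - alpha)) * gpareto_inv alpha (p / q).
Proof.
move=> p0 q0; have pq0 : 0 < p / q by rewrite divr_gt0.
have b0 : 0 < 1 + (1 - alpha) * gpareto_inv alpha (p / q).
  by rewrite gpareto_bracket// powR_gt0.
rewrite -[RHS](@gparetoK _ alpha); last first.
  rewrite mulrDr addrA gpareto_bracket// mulrCA -{1}[_ `^ _]mulr1 -mulrDr.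
  by rewrite mulr_gt0// powR_gt0.
by rewrite -gpareto_mul// gpareto_invK// mulrCA divff ?mulr1// gt_eqF.
Qed.

(** * The history in the coordinate [x = gpareto_inv alpha q] *)

Section History.
Variables (R : realType) (alpha : R) (T : nat) (w s q : nat -> R).
Hypothesis alpha_le1 : alpha <= 1.
Hypothesis H : is_history T w s q.
Local Notation b := (1 - alpha).
Local Notation X := (gpareto_inv alpha).

Definition hist_x (j : nat) : R := gpareto_inv alpha (q j).

Definition hist_slope (j : nat) : R :=
  (s j.+1 - s j) / (hist_x j.+1 - hist_x j).

(** The inverse of the affine piece of [v] with slope [hist_slope j]: it sends a price to its
    coordinate. Where the bracket is positive, [Gbar] with index [j] is
    [gpareto alpha \o hist_line j]. *)
Definition hist_line (j : nat) (u : R) : R :=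
  hist_x j + (u - s j) / hist_slope j.

Local Notation x := hist_x.
Local Notation c := hist_slope.
Local Notation l := hist_line.

Lemma history_s_lt (j k : nat) : (1 <= j)%N -> (j < k <= T)%N -> s j < s k.
Proof.
case: H => sH _ _ _ _ j0; elim: k => // k IH /andP[jk kT].
move: jk; rewrite ltnS leq_eqVlt => /predU1P[jk|jk].
  by rewrite jk; apply: sH; rewrite -{1}jk kT j0.
apply: (lt_trans (IH _)); first by rewrite jk ltnW.
by apply: sH; rewrite kT (leq_trans j0 (ltnW jk)).
Qed.

Lemma history_q_lt (j k : nat) : (1 <= j)%N -> (j < k <= T)%N -> q k < q j.
Proof.
case: H => _ _ qH _ _ j0; elim: k => // k IH /andP[jk kT].
move: jk; rewrite ltnS leq_eqVlt => /predU1P[jk|jk].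
  by rewrite jk; apply: qH; rewrite -{1}jk kT j0.
apply: (lt_trans _ (IH _)); last by rewrite jk ltnW.
by apply: qH; rewrite kT (leq_trans j0 (ltnW jk)).
Qed.

Lemma history_q_itv (j : nat) : (1 <= j <= T)%N -> 0 < q j < 1.
Proof.
move=> /andP[j1 jT]; case: (H) => _ q1 _ qT _; apply/andP; split.
  move: jT; rewrite leq_eqVlt => /predU1P[->//|jT].
  by apply: (lt_trans qT); rewrite history_q_lt// jT leqnn.
move: j1; rewrite leq_eqVlt => /predU1P[<-//|j1].
by apply: lt_trans q1; rewrite history_q_lt// j1.
Qed.

Lemma hist_x_gt0 (j : nat) : (1 <= j <= T)%N -> 0 < x j.
Proof. by move=> jT; rewrite gpareto_inv_gt0// history_q_itv. Qed.

Lemma hist_x_lt (j k : nat) : (1 <= j)%N -> (j < k <= T)%N -> x j < x k.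
Proof.
move=> j1 jk; rewrite gpareto_inv_lt ?history_q_lt//.
have /andP[jk' kT] := jk.
have k1 : (1 <= k <= T)%N by rewrite kT (leq_trans j1 (ltnW jk')).
by have /andP[] := history_q_itv k1.
Qed.

Lemma hist_slope_gt0 (j : nat) : (1 <= j < T)%N -> 0 < c j.
Proof.
move=> /andP[j1 jT]; rewrite divr_gt0 ?subr_gt0//.
  by rewrite history_s_lt// leqnn.
by rewrite hist_x_lt// leqnn.
Qed.

Lemma hist_lineE (j : nat) (u : R) :
  l j u = x j - s j / c j + (c j)^-1 * u.
Proof. by rewrite /hist_line; ring. Qed.

Lemma hist_line_left (j : nat) : l j (s j) = x j.
Proof. by rewrite /hist_line subrr mul0r addr0. Qed.

Lemma hist_line_right (j : nat) : (1 <= j < T)%N -> l j (s j.+1) = x j.+1.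
Proof.
move=> /andP[j1 jT].
have sj : s j < s j.+1 by rewrite history_s_lt// leqnn.
have xj : x j < x j.+1 by rewrite hist_x_lt// leqnn.
by rewrite /hist_line /hist_slope; field; rewrite !subr_eq0 !gt_eqF.
Qed.

Lemma is_derive_gpareto_line (j : nat) (u : R) : 0 < 1 + b * l j u ->
  is_derive u (1 : R) (gpareto alpha \o l j)
    (- (gpareto alpha (l j u) / (1 + b * l j u)) / c j).
Proof.
move=> bl; have d1 := is_derive_affine (x j - s j / c j) (c j)^-1 u.
rewrite (_ : (fun _ => _) = l j) in d1; last first.
  by apply/funext => ?; rewrite hist_lineE.
exact: (@is_derive1_comp R _ (l j) u _ _ (is_derive_gpareto bl) d1).
Qed.

Lemma is_derive_Gbar (j : nat) (u : R) : (1 <= j < T)%N -> 0 < 1 + b * l j u ->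
  is_derive u (1 : R) (Gbar alpha s q j)
    (- (gpareto alpha (l j u) / (1 + b * l j u)) / c j).
Proof.
move=> /andP[j1 jT] bl.
have /andP[q0 q1] : 0 < q j < 1 by rewrite history_q_itv// j1 ltnW.
have /andP[q0' _] : 0 < q j.+1 < 1 by rewrite history_q_itv.
have sj : s j < s j.+1 by rewrite history_s_lt// leqnn.
have xj : x j < x j.+1 by rewrite hist_x_lt// leqnn.
have xE : x j.+1 = x j + q j `^ (- b) * X (q j.+1 / q j).
  exact: gpareto_inv_div.
have P0 : 0 < q j `^ (- b) by rewrite powR_gt0.
pose Y := X (q j.+1 / q j).
have Y0 : Y != 0.
  by apply/eqP => Y0; move: xj; rewrite xE -/Y Y0 mulr0 addr0 ltxx.
(* [t] is the argument of [gpareto] in [Gbar]. By [gpareto_inv_div] the line is an affine function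
   of [t], and the brackets at the two differ by the factor [q j] raised to [- b]. *)
pose t v := Y * ((v - s j) / (s j.+1 - s j)).
have lE : l j u = x j + q j `^ (- b) * t u.
  rewrite /hist_line /hist_slope xE /t -/Y; field.
  by rewrite subr_eq0 gt_eqF// addrAC subrr add0r mulf_neq0// gt_eqF.
have blE : 1 + b * l j u = q j `^ (- b) * (1 + b * t u).
  rewrite lE mulrDr addrA gpareto_bracket//; ring.
have bt : 0 < 1 + b * t u by move: bl; rewrite blE pmulr_rgt0.
have d1 := is_derive_affine (- Y * s j / (s j.+1 - s j)) (Y / (s j.+1 - s j)) u.
have tE : t = fun v => - Y * s j / (s j.+1 - s j) + Y / (s j.+1 - s j) * v.
  by apply/funext => v; rewrite /t; field; rewrite subr_eq0 gt_eqF.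
rewrite -tE in d1.
have d2 := @is_derive1_comp R _ t u _ _ (is_derive_gpareto bt) d1.
have d3 := @is_deriveZ R R R _ (q j) u 1 _ d2.
apply: (is_derive_eq d3); rewrite /GRing.scale/=.
rewrite blE lE -gpareto_mul// /hist_slope xE -/Y; field.
rewrite [_ + _ - x j]addrAC subrr add0r mulf_neq0 ?(gt_eqF P0)//=.
by rewrite subr_eq0 (gt_eqF sj) (gt_eqF bt).
Qed.

(** The condition on the line makes one formula serve both ends of a piece: [k = j] for [phiQ_upper]
    and [k = j + 1] for [phiQ_lower]. *)
Lemma div_derive1_Gbar (j k : nat) : (1 <= j < T)%N -> (1 <= k <= T)%N ->
  l j (s k) = x k ->
  q k / derive1 (Gbar alpha s q j) (s k) = - (q k `^ (- b) * c j).
Proof.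
move=> jT kT lx; have /andP[q0 _] := history_q_itv kT.
have P0 : 0 < q k `^ (- b) by rewrite powR_gt0.
have bl : 0 < 1 + b * l j (s k) by rewrite lx gpareto_bracket.
rewrite derive1E (@derive_val _ _ _ _ _ _ _ (is_derive_Gbar jT bl)).
rewrite lx gpareto_bracket// gpareto_invK//.
by field; rewrite !gt_eqF// hist_slope_gt0.
Qed.

Lemma phiQ_lowerE (i : nat) : (2 <= i <= T.-1)%N ->
  phiQ_lower alpha s q i = s i - q i `^ (- b) * c i.-1.
Proof.
case: i => [|[|i]]// /andP[_ iT]; rewrite /phiQ_lower/= div_derive1_Gbar//.
- by case: T iT => //= n; rewrite ltnS => /ltnW.
- by rewrite (leq_trans iT)// leq_pred.
- by rewrite hist_line_right//; case: T iT => //= n; rewrite ltnS => /ltnW.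
Qed.

Lemma phiQ_upperE (i : nat) : (2 <= i <= T.-1)%N ->
  phiQ_upper alpha s q i = s i - q i `^ (- b) * c i.
Proof.
move=> /andP[i2 iT]; have iT' : (i < T)%N.
  by case: T iT => //=; case: i i2.
rewrite /phiQ_upper div_derive1_Gbar ?hist_line_left//.
  by rewrite (ltnW i2).
by rewrite (ltnW i2) (ltnW iT').
Qed.

(** * Bounds valid for every feasible curve *)

Section Feasible.
Variable F : valuation_distr R.
Hypothesis FQ : Qfeasible alpha T s q F.
Local Notation v := (vcurve alpha F).

Lemma Qfeasible_concave : increasing_concave_v alpha F.
Proof. by case: FQ => -[/regular_increasing_concave_v|]; auto. Qed.

Lemma vcurve_hist_x (j : nat) : (1 <= j <= T)%N -> v (x j) = s j.
Proof.
move=> jT; case: FQ => _ /(_ _ jT) tj.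
rewrite /hist_x -tj vcurve_gpareto_inv//; first exact: Qfeasible_concave.
by rewrite /in_support tj history_q_itv.
Qed.

Lemma vcurve_ge_chord (j : nat) (y : R) : (1 <= j < T)%N -> x j <= y <= x j.+1 ->
  s j + c j * (y - x j) <= v y.
Proof.
move=> /andP[j1 jT].
have xj : x j < x j.+1 by rewrite hist_x_lt// leqnn.
have vj : v (x j) = s j by rewrite vcurve_hist_x// j1 ltnW.
have vj1 : v (x j.+1) = s j.+1 by rewrite vcurve_hist_x.
case/andP; rewrite le_eqVlt => /predU1P[<- _|jy].
  by rewrite subrr mulr0 addr0 vj.
have D0 : 0 < x j.+1 - x j by rewrite subr_gt0.
rewrite le_eqVlt => /predU1P[->|yj].
  by rewrite vj1 /hist_slope divfK ?gt_eqF// addrC subrK.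
have := vcurve_chord Qfeasible_concave (hist_x_gt0 _) jy yj.
rewrite j1 (ltnW jT) vj vj1 => /(_ isT) h.
rewrite /hist_slope mulrAC -lerBrDl ler_pdivrMr//.
exact: chord_le_interp.
Qed.

(** The prolonged chord of a concave [v] lies above its graph outside the piece; for inverse
    functions the inequality is reversed. This is what makes the interpolation of the history a
    maximum of lines. *)
Lemma hist_line_le (j k : nat) : (1 <= j < T)%N -> (1 <= k <= T)%N ->
  l j (s k) <= x k.
Proof.
move=> /[dup] jT' /andP[j1 jT] /[dup] kT' /andP[k1 kT].
have xj : x j < x j.+1 by rewrite hist_x_lt// leqnn.
have sj : s j < s j.+1 by rewrite history_s_lt// leqnn.
have jT1 : (1 <= j <= T)%N by rewrite j1 ltnW.
have vj : v (x j) = s j by rewrite vcurve_hist_x// j1 ltnW.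
have vj1 : v (x j.+1) = s j.+1 by rewrite vcurve_hist_x.
have vk : v (x k) = s k by rewrite vcurve_hist_x.
rewrite /hist_line -lerBrDl ler_pdivrMr ?hist_slope_gt0//.
rewrite /hist_slope mulrA ler_pdivlMr ?subr_gt0//.
have [kj|jk|->] := ltngtP k j; last by rewrite !subrr !mul0r.
- have xkj : x k < x j by rewrite hist_x_lt// kj ltnW.
  have := vcurve_chord Qfeasible_concave (hist_x_gt0 kT') xkj xj.
  by rewrite vj vj1 vk; exact: chord_extend_left.
- move: jk; rewrite leq_eqVlt => /predU1P[<-|jk]; first by rewrite mulrC.
  have xjk : x j.+1 < x k by rewrite hist_x_lt// jk.
  have := vcurve_chord Qfeasible_concave (hist_x_gt0 jT1) xj xjk.
  by rewrite vj vj1 vk; exact: chord_extend_right.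
Qed.

Lemma hist_slope_nonincr (i : nat) : (2 <= i < T)%N -> c i <= c i.-1.
Proof.
case: i => [|[|i]]// /andP[_ iT] /=.
have i1 : (1 <= i.+1 <= T)%N by rewrite /= ltnW// ltnW.
have x12 : x i.+1 < x i.+2 by rewrite hist_x_lt// leqnn ltnW.
have x23 : x i.+2 < x i.+3 by rewrite hist_x_lt// leqnn.
have := vcurve_chord Qfeasible_concave (hist_x_gt0 i1) x12 x23.
rewrite !vcurve_hist_x ?(ltnW iT) ?iT//.
rewrite /hist_slope ler_pdivrMr ?subr_gt0// mulrAC ler_pdivlMr ?subr_gt0//.
Qed.

(** Put [y = hist_line j u]. The chord bound gives [u <= v y], so the tail at [u] is at least the
    tail at [v y], which [gpareto_le_tail_vcurve] bounds below by [gpareto alpha y]. *)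
Lemma tail_ge_line (j : nat) (u : R) : (1 <= j < T)%N -> s j <= u <= s j.+1 ->
  gpareto alpha (l j u) <= tail F u.
Proof.
move=> jT /andP[ju uj]; have c0 := hist_slope_gt0 jT.
have x0 : 0 < x j by rewrite hist_x_gt0//; case/andP: jT => -> /ltnW.
have xl : x j <= l j u by rewrite lerDl divr_ge0 ?subr_ge0 ?(ltW c0).
have lx : l j u <= x j.+1.
  by rewrite -hist_line_right// !hist_lineE lerD2l ler_pM2l// invr_gt0.
apply: (le_trans (gpareto_le_tail_vcurve alpha_le1 Qfeasible_concave _)).
  exact: lt_le_trans xl.
apply: tail_le; have := vcurve_ge_chord jT; move=> /(_ (l j u)).
rewrite xl lx => /(_ isT); apply: le_trans.
by rewrite /hist_line addrAC subrr add0r mulrC divfK ?gt_eqF// addrC subrK.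
Qed.

Lemma Qfeasible_behavior_bounds (i : nat) (phi : R) : (2 <= i <= T.-1)%N ->
  pricing_index_value alpha F (s i) (q i) phi ->
  phiQ_lower alpha s q i <= phi <= phiQ_upper alpha s q i.
Proof.
move=> /[dup] iT /andP[i2 iT1]; rewrite phiQ_lowerE// phiQ_upperE//.
have {iT1} iT1 : (i < T)%N by case: T iT1 => //=; case: i i2 {iT}.
have i1 : (1 <= i <= T)%N by rewrite (ltnW i2) (ltnW iT1).
have i1T : (1 <= i < T)%N by rewrite (ltnW i2).
have p1T : (1 <= i.-1 < T)%N by case: i i2 i1T {iT iT1 i1} => [|[|i]]// _ /= /ltnW.
have pE : i.-1.+1 = i by case: i i2 {iT iT1 i1 i1T p1T}.
have /andP[q0 q1] := history_q_itv i1.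
have ci := hist_slope_gt0 i1T; have cp := hist_slope_gt0 p1T.
have x0 := hist_x_gt0 i1.
have P0 : 0 < q i `^ (- b) by rewrite powR_gt0.
have si : s i < s i.+1 by rewrite history_s_lt ?leqnn//; case/andP: i1T.
have sp : s i.-1 < s i.
  by rewrite -{2}pE history_s_lt//; case/andP: p1T => // _ ->; rewrite leqnn.
have xi : x i < x i.+1 by rewrite hist_x_lt ?leqnn//; case/andP: i1T.
have xp : x i.-1 < x i.
  by rewrite -{2}pE hist_x_lt//; case/andP: p1T => // _ ->; rewrite leqnn.
have ti : tail F (s i) = q i by apply: FQ.2.
case=> [[Fd ->]|[vr [vl [m [dr dl vrl /andP[rm ml] ->]]]]]; last first.
  (* At a kink, [v] lies above the chords of both adjacent pieces and meets them at [x i].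
     Difference quotients from the left are therefore at most [c i.-1], those from the right at
     least [c i]. *)
  rewrite !lerD2l !lerN2 !ler_pM2l//; apply/andP; split.
    apply: (le_trans ml); apply: (cvgr_to_le dl); near=> h.
    have h0 : h < 0 by near: h; exact: nbhs_left_lt.
    have hx : x i.-1 - x i < h by near: h; apply: nbhs_left_gt; rewrite subr_lt0.
    rewrite mulrC ler_ndivrMr// -/(x i) vcurve_hist_x//.
    have := @vcurve_ge_chord i.-1 (x i + h) p1T; rewrite pE => /(_ _).
    rewrite -lerBlDl (ltW hx) gerDl (ltW h0) => /(_ isT).
    have sE : s i = s i.-1 + c i.-1 * (x i - x i.-1).
      by rewrite /hist_slope pE divfK ?subr_eq0 ?gt_eqF//; ring.
    rewrite lerBrDl sE; apply: le_trans.
    by rewrite le_eqVlt; apply/orP; left; apply/eqP; ring.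
  apply: (le_trans _ rm); apply: (cvgr_to_ge dr); near=> h.
  have h0 : 0 < h by near: h; exact: nbhs_right_gt.
  have hx : h < x i.+1 - x i by near: h; apply: nbhs_right_lt; rewrite subr_gt0.
  rewrite mulrC ler_pdivlMr// -/(x i) vcurve_hist_x//.
  have := @vcurve_ge_chord i (x i + h) i1T.
  rewrite lerDl (ltW h0) -lerBrDl (ltW hx) => /(_ isT).
  by rewrite [x i + h - _]addrAC subrr add0r lerBrDl.
(* At a smooth point the tail itself is compared with the two Pareto pieces: it lies above them on
   their sides of [s i] and meets them there, which bounds its derivative [- D] from both sides. *)
pose D := density F (s i).
have Dt : is_derive (s i) (1 : R) (tail F) (- D).
  have dF : is_derive (s i) (1 : R) (F : R -> R) D.
    by rewrite /D /density derive1E; exact: derivableP.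
  have := is_deriveB (is_derive_cst (1 : R) (s i) (1 : R)) dF; rewrite sub0r.
  exact.
pose K := q i / q i `^ (- b).
have K0 : 0 < K by rewrite divr_gt0.
have dl j : l j (s i) = x i ->
    is_derive (s i) (1 : R) (gpareto alpha \o l j) (- K / c j).
  move=> lx; have blx : 1 + b * l j (s i) = q i `^ (- b).
    by rewrite lx gpareto_bracket.
  have := @is_derive_gpareto_line j (s i).
  by rewrite blx lx /hist_x gpareto_invK// /K => /(_ P0).
have li : l i (s i) = x i by exact: hist_line_left.
have lp : l i.-1 (s i) = x i by rewrite -pE hist_line_right// pE.
have Dr : D <= K / c i.
  suff : 0 <= - D - (- K / c i) by rewrite mulNr opprK addrC subr_ge0.
  apply: (is_derive_right_ge0 (is_deriveB Dt (dl i li))).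
  near=> h; rewrite !fctE /= li ti {1}/hist_x gpareto_invK// subrr subr_ge0.
  have h0 : 0 < h by near: h; exact: nbhs_right_gt.
  have hs : h < s i.+1 - s i by near: h; apply: nbhs_right_lt; rewrite subr_gt0.
  by apply: tail_ge_line => //; rewrite lerDl (ltW h0) -lerBrDl ltW.
have Dp : K / c i.-1 <= D.
  suff : 0 <= - K / c i.-1 - - D by rewrite opprK addrC mulNr subr_ge0.
  apply: (is_derive_left_ge0 (is_deriveB (dl i.-1 lp) Dt)).
  near=> h; rewrite !fctE /= lp ti {1}/hist_x gpareto_invK// subrr subr_le0.
  have h0 : 0 < h by near: h; exact: nbhs_right_gt.
  have hs : h < s i - s i.-1 by near: h; apply: nbhs_right_lt; rewrite subr_gt0.
  by apply: tail_ge_line => //; rewrite pE gerBl (ltW h0) lerBrDr -lerBrDl ltW.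
have Pci : 0 < q i `^ (- b) * c i by exact: mulr_gt0.
have Pcp : 0 < q i `^ (- b) * c i.-1 by exact: mulr_gt0.
(* Positivity of the density keeps the quotient in [pricing_index] away from the default value of
   division by 0. *)
have D0 : 0 < D by apply: lt_le_trans Dp; rewrite divr_gt0.
rewrite /pricing_index ti -/D !lerD2l !lerN2; apply/andP; split.
  move: Dp; rewrite /K -mulrA -invfM ler_pdivrMr//.
  by rewrite ler_pdivrMr// mulrC.
move: Dr; rewrite /K -mulrA -invfM ler_pdivlMr//.
by rewrite ler_pdivlMr// mulrC.
Unshelve. all: by end_near. Qed.

End Feasible.

End History.

(** * Construction of the piecewise affine curve and its extreme pricing indices *)

Lemma valuation_distrP (R : realType) (f : R -> R) :
  {homo f : x y / x <= y} -> continuous f ->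
  f x @[x --> -oo] --> (0 : R) -> f x @[x --> +oo] --> (1 : R) ->
  exists F : valuation_distr R, (F : R -> R) = f.
Proof.
move=> fi fc f0 f1.
pose m1 := isCumulative.Build R _ R f fi (right_continuousW fc).
pose m2 := isCumulativeBounded.Build R 0 1 f f0 f1.
pose F : valuation_distr R := HB.pack f m1 m2.
by exists F.
Qed.

Lemma continuous_bigmax (R : realType) (I : Type) (r : seq I) (P : pred I)
    (f : I -> R -> R) : (forall i, P i -> continuous (f i)) ->
  continuous (fun u => \big[Num.max/(0 : R)]_(i <- r | P i) f i u).
Proof.
move=> fc; apply: (@continuous_big R I Num.max 0 P _ R r f fc).
move=> u; apply: (@continuous_max R (R * R)%type fst snd u).
  exact: cvg_fst.
exact: cvg_snd.
Qed.

Section PiecewiseCurve.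
Variables (R : realType) (alpha : R) (T : nat) (w s q : nat -> R).
Hypothesis alpha_le1 : alpha <= 1.
Hypothesis T3 : (3 <= T)%N.
Hypothesis H : is_history T w s q.
Variable F0 : valuation_distr R.
Hypothesis F0Q : Qfeasible alpha T s q F0.
Local Notation b := (1 - alpha).
Local Notation X := (gpareto_inv alpha).
Local Notation x := (hist_x alpha q).
Local Notation c := (hist_slope alpha s q).
Local Notation l := (hist_line alpha s q).

(* The inverse of the interpolating curve v, extended by 0 to the left of the
   support; concavity of the data turns the interpolation into a maximum of
   lines, and the bounds j > 0 and j < T select the T - 1 pieces. *)
Definition hist_env (u : R) : R :=
  \big[Num.max/0]_(j < T | (0 < j)%N) l j u.
Local Notation E := hist_env.

Lemma hist_line_cont (j : nat) : continuous (l j).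
Proof.
move=> u; apply/differentiable_continuous/derivable1_diffP.
rewrite (_ : l j = fun u => x j - s j / c j + (c j)^-1 * u).
  by case: (is_derive_affine (x j - s j / c j) (c j)^-1 u).
by apply/funext => ?; rewrite hist_lineE.
Qed.

Lemma hist_env_ge0 (u : R) : 0 <= E u.
Proof. exact: bigmax_ge_id. Qed.

Lemma hist_line_le_env (j : nat) (u : R) : (1 <= j < T)%N -> l j u <= E u.
Proof.
move=> /andP[j1 jT].
exact: (@le_bigmax_cond _ R 'I_T 0 (Ordinal jT) _ (fun j => l j u)).
Qed.

Lemma hist_line_lt (j : nat) (u v : R) : (1 <= j < T)%N -> u < v -> l j u < l j v.
Proof.
by move=> jT uv; rewrite !hist_lineE ltrD2l ltr_pM2l// invr_gt0 (hist_slope_gt0 alpha_le1 H).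
Qed.

(** Positivity at [v] deals with the constant term 0 of the maximum, which makes the envelope flat
    to the left of the support. *)
Lemma hist_env_lt (u v : R) : u < v -> 0 < E v -> E u < E v.
Proof.
move=> uv Ev; apply: bigmax_lt => // j j0.
have jT : (1 <= j < T)%N by rewrite j0 ltn_ord.
exact: lt_le_trans (hist_line_lt jT uv) (hist_line_le_env _ jT).
Qed.

Lemma hist_env_le (u v : R) : u <= v -> E u <= E v.
Proof.
rewrite le_eqVlt => /predU1P[->//|uv]; have := hist_env_ge0 v.
rewrite le_eqVlt => /predU1P[Ev|/(hist_env_lt uv)/ltW//].
rewrite -Ev; apply: bigmax_le => // j j0.
have jT : (1 <= j < T)%N by rewrite j0 ltn_ord.
by rewrite Ev (le_trans (ltW (hist_line_lt jT uv)))// hist_line_le_env.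
Qed.

(** A maximum of affine functions, the constant 0 among them, is convex. *)
Lemma hist_env_chord (u v t : R) : u < v -> v < t ->
  (E v - E u) * (t - v) <= (E t - E v) * (v - u).
Proof.
move=> uv vt; have tu : 0 < t - u by rewrite subr_gt0 (lt_trans uv).
have v1 : 0 < v - u by rewrite subr_gt0.
have t1 : 0 < t - v by rewrite subr_gt0.
have : E v <= ((t - v) * E u + (v - u) * E t) / (t - u).
  apply: bigmax_le.
    by rewrite divr_ge0 ?(ltW tu)// addr_ge0// mulr_ge0 ?hist_env_ge0// ltW.
  move=> j j0; have jT : (1 <= j < T)%N by rewrite j0 ltn_ord.
  rewrite ler_pdivlMr//.
  have -> : l j v * (t - u) = (t - v) * l j u + (v - u) * l j t.
    by rewrite !hist_lineE; ring.
  by rewrite lerD// ler_wpM2l ?hist_line_le_env// ltW.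
rewrite ler_pdivlMr//; lra.
Qed.

(** By [hist_line_le] no line exceeds line [j] at either end of the piece, hence none does in
    between, all of them being affine. *)
Lemma hist_env_line (j : nat) (u : R) : (1 <= j < T)%N -> s j <= u <= s j.+1 ->
  E u = l j u.
Proof.
move=> /[dup] jT /andP[j1 jT1] /andP[ju uj].
have sj : s j < s j.+1 by rewrite (history_s_lt H)// leqnn.
have jT2 : (1 <= j <= T)%N by rewrite j1 ltnW.
have c0 := hist_slope_gt0 alpha_le1 H jT.
have xl : x j <= l j u by rewrite lerDl divr_ge0 ?subr_ge0 ?(ltW c0).
apply/eqP; rewrite eq_le hist_line_le_env// andbT; apply: bigmax_le.
  exact: le_trans (ltW (hist_x_gt0 alpha_le1 H jT2)) xl.
move=> k k0; have kT : (1 <= k < T)%N by rewrite k0 ltn_ord.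
have k1 := hist_line_le alpha_le1 H F0Q kT jT2.
have k2 : l k (s j.+1) <= x j.+1 by apply: (hist_line_le alpha_le1 H F0Q kT).
have D0 : 0 < s j.+1 - s j by rewrite subr_gt0.
have aff m : l m u = ((s j.+1 - u) * l m (s j) + (u - s j) * l m (s j.+1)) /
    (s j.+1 - s j).
  by rewrite !hist_lineE; move: (c m)^-1 => d; field; rewrite subr_eq0 gt_eqF.
rewrite !aff ler_pM2r ?invr_gt0// hist_line_left (hist_line_right alpha_le1 H)//.
by rewrite lerD// ler_wpM2l// subr_ge0.
Qed.

Lemma hist_env_node (j : nat) : (1 <= j <= T)%N -> E (s j) = x j.
Proof.
move=> /andP[j1]; rewrite leq_eqVlt => /predU1P[jT|jT].
  (* The last node starts no piece and is reached as the right end of piece [T - 1]. *)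
  have jp : j = j.-1.+1 by case: j j1 {jT}.
  have pT : (1 <= j.-1 < T)%N.
    by rewrite jT; case: T T3 => // -[|n]//= _; rewrite leqnn.
  rewrite jp (hist_env_line pT) ?(hist_line_right alpha_le1 H)//.
  rewrite lexx andbT ltW// (history_s_lt H) ?leqnn//; case/andP: pT => //.
have jT' : (1 <= j < T)%N by rewrite j1.
by rewrite (hist_env_line jT') ?hist_line_left// lexx ltW// (history_s_lt H) ?leqnn.
Qed.

Lemma hist_env_cont : continuous E.
Proof. by apply: continuous_bigmax => i _; exact: hist_line_cont. Qed.

Lemma gpareto_env_cont : continuous (gpareto alpha \o E).
Proof.
move=> u; apply: continuous_comp; first exact: hist_env_cont.
have bE : 0 < 1 + b * E u by rewrite bracket_gt0// hist_env_ge0.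
apply/differentiable_continuous/derivable1_diffP.
by case: (is_derive_gpareto bE).
Qed.

Lemma piecewise_curve : exists F : valuation_distr R,
  forall u, tail F u = gpareto alpha (E u).
Proof.
have T1 : (1 <= 1 < T)%N by rewrite (leq_trans _ T3).
have c1 := hist_slope_gt0 alpha_le1 H T1.
have [|||| F FE] := @valuation_distrP R (fun u => 1 - gpareto alpha (E u)).
- move=> u v uv; rewrite lerD2l lerN2 gpareto_le ?hist_env_le//.
  by rewrite bracket_gt0// hist_env_ge0.
- by move=> u; apply: cvgB; [exact: cvg_cst|exact: gpareto_env_cont].
- have [m mE] : exists m, forall u, u <= m -> E u = 0.
    (* Line [j] vanishes at [s j - c j * x j]. To the left of all these roots only the constant 0
       survives in the envelope, so the tail is 1. *)
    exists (\big[Num.min/0]_(j < T | (0 < j)%N) (s j - c j * x j)) => u um.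
    apply/eqP; rewrite eq_le hist_env_ge0 andbT; apply: bigmax_le => // j j0.
    have jT : (1 <= j < T)%N by rewrite j0 ltn_ord.
    have cj := hist_slope_gt0 alpha_le1 H jT.
    rewrite /hist_line -lerBrDl sub0r ler_pdivrMr// lerBlDl.
    rewrite mulNr [x j * _]mulrC; apply: (le_trans um).
    exact: (@bigmin_le_cond _ R 'I_T 0 j _ (fun j => s j - c j * x j)).
  apply: (@cvg_trans _ (cst (0 : R) @ -oo)); last exact: cvg_cst.
  apply: near_eq_cvg; near=> u => /=.
  have um : u <= m by near: u; apply: nbhs_ninfty_le; exact: num_real.
  by rewrite mE// gpareto0 subrr.
- rewrite -[X in _ --> X]subr0; apply: cvgB; first exact: cvg_cst.
  (* The first line alone, having positive slope, drives the envelope to infinity. *)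
  have Ey : E u @[u --> +oo] --> +oo.
    apply/cvgryPge => A; near=> u.
    apply: le_trans (hist_line_le_env _ T1).
    rewrite /hist_line -lerBlDl ler_pdivlMr// lerBrDr; near: u.
    by apply: nbhs_pinfty_ge; exact: num_real.
  exact: (cvg_comp _ _ Ey (cvgy_gpareto alpha_le1)).
by exists F => u; rewrite /tail FE opprB addrC subrK.
Unshelve. all: by end_near. Qed.

Section Curve.
Variable F : valuation_distr R.
Hypothesis FE : forall u, tail F u = gpareto alpha (E u).

Lemma piecewise_inv (u : R) : X (tail F u) = E u.
Proof. by rewrite FE gparetoK// bracket_gt0// hist_env_ge0. Qed.

Lemma piecewise_support (u : R) : in_support F u -> 0 < E u.
Proof.
move=> /andP[_]; rewrite FE => u1; rewrite lt_neqAle hist_env_ge0 andbT.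
by apply/eqP => E0; move: u1; rewrite -E0 gpareto0 ltxx.
Qed.

Lemma piecewise_node (j : nat) : (1 <= j <= T)%N -> tail F (s j) = q j.
Proof.
move=> jT; rewrite FE hist_env_node// gpareto_invK//.
by have /andP[] := history_q_itv H jT.
Qed.

Lemma piecewise_cont : continuous (F : R -> R).
Proof.
have -> : (F : R -> R) = (fun u => 1 - gpareto alpha (E u)).
  by apply/funext => u; rewrite -FE /tail opprB addrC subrK.
by move=> u; apply: cvgB; [exact: cvg_cst|exact: gpareto_env_cont].
Qed.

Lemma piecewise_decr (u v : R) : in_support F u -> in_support F v -> u < v ->
  tail F v < tail F u.
Proof.
move=> uF vF uv; rewrite !FE gpareto_lt ?bracket_gt0 ?hist_env_ge0//.
by rewrite hist_env_lt// piecewise_support.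
Qed.

Lemma piecewise_Qfeasible : Qfeasible alpha T s q F.
Proof.
split; last exact: piecewise_node.
right; apply: convex_increasing_concave_v => //.
- exact: piecewise_cont.
- exact: piecewise_decr.
- by move=> u v t _ _ _ uv vt; rewrite !piecewise_inv hist_env_chord.
Qed.

Lemma piecewise_vcurve (j : nat) (y : R) : (1 <= j < T)%N ->
  x j <= y <= x j.+1 -> vcurve alpha F y = s j + c j * (y - x j).
Proof.
move=> /[dup] jT /andP[j1 jT1] /andP[jy yj].
have jT2 : (1 <= j <= T)%N by rewrite j1 ltnW.
have c0 := hist_slope_gt0 alpha_le1 H jT.
have y0 : 0 < y := lt_le_trans (hist_x_gt0 alpha_le1 H jT2) jy.
set u := s j + _.
have lu : l j u = y.
  by rewrite /hist_line /u addrAC subrr add0r mulrAC divff ?gt_eqF// mul1r addrC subrK.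
have Eu : E u = y.
  rewrite (hist_env_line jT)//; apply/andP; split.
    by rewrite lerDl mulr_ge0 ?subr_ge0// ltW.
  rewrite leNgt; apply/negP => /(hist_line_lt jT).
  by rewrite lu (hist_line_right alpha_le1 H)// ltNge yj.
have uF : in_support F u.
  rewrite /in_support FE Eu gpareto_gt0 ?gpareto_lt1//.
  by rewrite bracket_gt0// ltW.
by rewrite -[in LHS]Eu -piecewise_inv vcurve_gpareto_inv_decr//; exact: piecewise_decr.
Qed.

Lemma piecewise_extremes (i : nat) : (2 <= i <= T.-1)%N ->
  pricing_index_value alpha F (s i) (q i) (phiQ_lower alpha s q i) /\
  pricing_index_value alpha F (s i) (q i) (phiQ_upper alpha s q i).
Proof.
move=> /[dup] iT /andP[i2 iT1].
rewrite (phiQ_lowerE alpha_le1 H)// (phiQ_upperE alpha_le1 H)//.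
have {iT1} iT1 : (i < T)%N by case: T iT1 => //=; case: i i2 {iT}.
have i1 : (1 <= i <= T)%N by rewrite (ltnW i2) (ltnW iT1).
have i1T : (1 <= i < T)%N by rewrite (ltnW i2).
have i2T : (2 <= i < T)%N by rewrite i2.
have p1T : (1 <= i.-1 < T)%N.
  by case: i i2 i1T {iT iT1 i1 i2T} => [|[|i]]// _ /= /ltnW.
have pE : i.-1.+1 = i by case: i i2 {iT iT1 i1 i1T p1T i2T}.
have /andP[q0 q1] := history_q_itv H i1.
have ci := hist_slope_gt0 alpha_le1 H i1T.
have cp := hist_slope_gt0 alpha_le1 H p1T.
have si : s i < s i.+1 by rewrite (history_s_lt H) ?leqnn//; case/andP: i1T.
have sp : s i.-1 < s i.
  by rewrite -{2}pE (history_s_lt H)//; case/andP: p1T => // _ ->; rewrite leqnn.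
have xi : x i < x i.+1.
  by rewrite (hist_x_lt alpha_le1 H) ?leqnn//; case/andP: i1T.
have xp : x i.-1 < x i.
  by rewrite -{2}pE (hist_x_lt alpha_le1 H)//; case/andP: p1T => // _ ->; rewrite leqnn.
have := hist_slope_nonincr alpha_le1 H F0Q i2T.
rewrite le_eqVlt => /predU1P[cE|clt]; last first.
  (* For distinct slopes, [v] is affine on each side of [x i]: its difference quotients are
     eventually constant, and the extreme values come from the two ends of the range of [m]. *)
  have vi : vcurve alpha F (x i) = s i.
    by rewrite (piecewise_vcurve i1T) ?subrr ?mulr0 ?addr0// lexx ltW.
  have dr : right_derivative (vcurve alpha F) (X (q i)) (c i).
    apply: (@cvg_trans _ (cst (c i) @ 0^'+)); last exact: cvg_cst.
    apply: near_eq_cvg; near=> h => /=.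
    have h0 : 0 < h by near: h; exact: nbhs_right_gt.
    have hx : h < x i.+1 - x i by near: h; apply: nbhs_right_lt; rewrite subr_gt0.
    rewrite -/(x i) vi (piecewise_vcurve i1T); last first.
      by rewrite lerDl (ltW h0) -lerBrDl ltW.
    by field; rewrite gt_eqF.
  have dl : left_derivative (vcurve alpha F) (X (q i)) (c i.-1).
    apply: (@cvg_trans _ (cst (c i.-1) @ 0^'-)); last exact: cvg_cst.
    apply: near_eq_cvg; near=> h => /=.
    have h0 : h < 0 by near: h; exact: nbhs_left_lt.
    have hx : x i.-1 - x i < h by near: h; apply: nbhs_left_gt; rewrite subr_lt0.
    rewrite -/(x i) vi (piecewise_vcurve p1T); last first.
      by rewrite pE gerDl (ltW h0) -lerBlDl ltW.
    have -> : s i = s i.-1 + c i.-1 * (x i - x i.-1).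
      by rewrite /hist_slope pE divfK ?subr_eq0 ?gt_eqF//; ring.
    by field; rewrite lt_eqF.
  by split; right; exists (c i), (c i.-1);
    [exists (c i.-1)|exists (c i)]; split; rewrite // lexx ltW.
(* For equal slopes the kink alternative, which demands [vr < vl], is closed. Lines [i - 1] and [i]
   now coincide, so near [s i] the tail is a single Pareto piece, [F] is differentiable there, and
   the two extremes agree. *)
have ti : tail F (s i) = q i by exact: piecewise_node.
have li : l i (s i) = x i by exact: hist_line_left.
have P0 : 0 < q i `^ (- b) by rewrite powR_gt0.
pose K := q i / q i `^ (- b).
have dl : is_derive (s i) (1 : R) (gpareto alpha \o l i) (- K / c i).
  have := @is_derive_gpareto_line R alpha s q i (s i).
  by rewrite li gpareto_bracket// gpareto_invK//; exact.
have lE u : l i u = l i.-1 u.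
  have := hist_line_right alpha_le1 H p1T; rewrite pE.
  rewrite /hist_line -cE => <-.
  by field; rewrite gt_eqF.
have dF : is_derive (s i) (1 : R) (F : R -> R) (K / c i).
  have := is_deriveB (is_derive_cst (1 : R) (s i) (1 : R)) dl.
  rewrite sub0r mulNr opprK; apply: near_eq_is_derive.
  near=> u; rewrite !fctE /=.
  have us : s i.-1 < u by near: u; exact: lt_nbhsr.
  have us' : u < s i.+1 by near: u; exact: lt_nbhsl.
  suff <- : tail F u = gpareto alpha (l i u) by rewrite /tail opprB addrC subrK.
  rewrite FE; congr gpareto; have [ui|iu] := leP u (s i).
    by rewrite lE (hist_env_line p1T)// pE ui ltW.
  by rewrite (hist_env_line i1T)// !ltW.
have Dd : density F (s i) = K / c i by rewrite /density derive1E (@derive_val _ _ _ _ _ _ _ dF).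
have pv : pricing_index_value alpha F (s i) (q i) (s i - q i `^ (- b) * c i).
  left; split; first by case: dF.
  rewrite /pricing_index ti Dd /K; congr (_ - _).
  by field; rewrite !gt_eqF.
by rewrite -cE.
Unshelve. all: by end_near. Qed.

End Curve.

End PiecewiseCurve.

Theorem proposition2 (R : realType) (alpha : R) (T : nat) (w s q : nat -> R)
  (halpha : 0 <= alpha <= 1) (hT : (3 <= T)%N)
  (hH : is_history T w s q)
  (hQ : exists F : valuation_distr R, Qfeasible alpha T s q F)
  (i : nat) (hi : (2 <= i <= T.-1)%N)
  (delta : R) (hdelta : 0 <= delta) :
  (delta < delta_crit alpha w s q i ->
     exists (F : valuation_distr R) (phi : R),
       Qfeasible_behavior alpha T s q i F phi /\
       ~ CE_restriction phi (w i) delta) /\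
  (delta_crit alpha w s q i <= delta ->
     forall (F : valuation_distr R) (phi : R),
       Qfeasible_behavior alpha T s q i F phi ->
       CE_restriction phi (w i) delta).
Proof.
have /andP[_ a1] := halpha; have [F0 F0Q] := hQ.
rewrite /CE_restriction /delta_crit; split.
  have [F FE] := piecewise_curve a1 hT hH.
  have FQ := piecewise_Qfeasible a1 hT hH F0Q FE.
  have [Fl Fu] := piecewise_extremes a1 hT hH F0Q FE hi.
  (* One curve serves both cases; the term of the maximum that exceeds [delta] tells which of its
     two extreme indices violates the restriction. *)
  rewrite lt_max => /orP[dl|du]; exists F.
    exists (phiQ_lower alpha s q i); split; first by [].
    by apply/negP; rewrite -ltNge (lt_le_trans dl)// -[leLHS]opprB -normrN ler_norm.
  exists (phiQ_upper alpha s q i); split; first by [].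
  by apply/negP; rewrite -ltNge (lt_le_trans du)// ler_norm.
(* Both terms being at most [delta], the interval from [phiQ_lower] to [phiQ_upper] lies within
   distance [delta] of [w i]. *)
rewrite ge_max => /andP[dl du] F phi [FQ Fphi].
have /andP[lphi phiu] := Qfeasible_behavior_bounds a1 hH FQ hi Fphi.
by rewrite ler_norml; apply/andP; split; lra.
Qed.
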